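(* Let $\alpha\in\mathbb{R}$ and $\beta\ge\tfrac12$, and let $$f_{\alpha,\beta,-1}(x)=\biggl[\frac{e^x\,\Gamma(x+\beta)}{x^{x+\beta-\alpha}}\biggr]^{-1},\qquad x\in(0,\infty).$$ Then the function $f_{\alpha,\beta,-1}$ is logarithmically completely monotonic on $(0,\infty)$ if and only if $\alpha\ge\beta$.
   Context: $\Gamma$ denotes the classical Euler gamma function, $\Gamma(x)=\int_0^\infty t^{x-1}e^{-t}\,dt$ for $x>0$. A positive function $f$ is said to be logarithmically completely monotonic on an interval $I$ if $f$ has derivatives of all orders on $I$ and $(-1)^n[\ln f(x)]^{(n)}\ge 0$ for all $x\in I$ and all $n\in\mathbb{N}=\{1,2,3,\dots\}$. *)

(* Defs.v *)
From Stdlib Require Import Reals.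
From Coquelicot Require Import Coquelicot.
Open Scope R_scope.

(* Meaningful for x > 0; the lower filter [at_right 0] makes the integral
   improper at 0 too, as needed for x < 1. *)
Definition Gamma (x : R) : R :=
  RInt_gen (fun t : R => Rpower t (x - 1) * exp (- t))
    (at_right 0) (Rbar_locally p_infty).

(* The interval is open, so the two-sided derivatives of a function on R at a
   point of (a, b) depend only on its values on (a, b). *)
Definition log_completely_monotonic (f : R -> R) (a b : Rbar) : Prop :=
  (forall x : R, Rbar_lt a x -> Rbar_lt x b -> 0 < f x) /\
  (forall (n : nat) (x : R),
      Rbar_lt a x -> Rbar_lt x b -> ex_derive_n f n x) /\
  (forall (n : nat) (x : R), (1 <= n)%nat ->
      Rbar_lt a x -> Rbar_lt x b ->
      0 <= (-1) ^ n * Derive_n (fun y : R => ln (f y)) n x).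

Definition f_neg1 (alpha beta x : R) : R :=
  / (exp x * Gamma (x + beta) / Rpower x (x + beta - alpha)).

(* Main.v *)
(* By Bohr-Mollerup, [ln Gamma] differs by a constant from the integral of
   [psi x = c + sum_k (1 / (1 + k) - 1 / (x + k))], since both are convex and
   satisfy [F (x + 1) = F x + ln x].  This makes every derivative of [ln f]
   explicit: with [Z_s x = sum_k 1 / (x + k) ^ s],
     (ln f)' x = ln x - psi (x + beta) + (beta - alpha) / x,
     (-1)^m (ln f)^(m+2) x = m! / x^(m+1)
       + (m+1)! ((alpha - beta) / x^(m+2) - Z_(m+2) (x + beta)).
   For [beta >= 1/2] the midpoint rule, applied to the convex function
   [s ^ - (m+2)] on unit intervals, gives [(m + 1) Z_(m+2) (x + beta) <= 1 / x^(m+1)],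
   hence the sign for orders at least 2.  The case [m = 0] makes
   [psi (x + beta) - ln x] decreasing; its limit is 0, so it is nonnegative,
   which settles order 1.  Conversely, [psi (x + beta) <= ln (x + beta)], so
   order 1 forces [alpha - beta >= - x ln (1 + beta / x)], which tends to 0 as [x -> 0]. *)
Require Import Defs.
From Stdlib Require Import Reals Factorial Lra Lia Psatz.
From Coquelicot Require Import Coquelicot.
Open Scope R_scope.

(** * The Gamma integral *)

Lemma exp_le (x y : R) : x <= y -> exp x <= exp y.
Proof.
  intros [H | ->]; [left; now apply exp_increasing | apply Rle_refl].
Qed.

(** For a nonnegative integrand the integral grows with the interval, so its supremum over compact
    intervals is also its limit. Recording the supremum lets later bounds on [Gamma] be proved on
    compact intervals only. *)
Lemma RInt_gen_bounded (f : R -> R) (M : R) :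
  (forall t, 0 < t -> continuous f t) ->
  (forall t, 0 < t -> 0 <= f t) ->
  (forall a b, 0 < a < b -> RInt f a b <= M) ->
  exists l, is_RInt_gen f (at_right 0) (Rbar_locally p_infty) l /\
    is_lub (fun v => exists a b, 0 < a < b /\ v = RInt f a b) l.
Proof.
  intros Hc Hp HM.
  assert (Hex : forall a b, 0 < a -> 0 < b -> ex_RInt f a b).
  { intros a b Ha Hb. apply (ex_RInt_continuous (V := R_CompleteNormedModule)).
    intros z Hz. apply Hc.
    apply Rlt_le_trans with (2 := proj1 Hz). now apply Rmin_pos. }
  destruct (completeness (fun v => exists a b, 0 < a < b /\ v = RInt f a b))
    as [l Hl].
  - exists M. intros v (a & b & Hab & ->). now apply HM.
  - exists (RInt f 1 2), 1, 2. split; [lra | reflexivity].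
  - exists l. split; [ | exact Hl].
    intros P [eps HP].
    assert (Hnear : exists a b, 0 < a < b /\ l - eps < RInt f a b).
    { apply Classical_Prop.NNPP. intros Hn.
      assert (l <= l - eps); [ | destruct eps; simpl in *; lra].
      apply (proj2 Hl). intros v (a & b & Hab & ->).
      apply Rnot_lt_le. intros H. apply Hn. exists a, b. now split. }
    destruct Hnear as (a0 & b0 & Hab0 & Hlow).
    apply (Filter_prod _ _ _ (fun a => 0 < a < a0) (fun b => b0 < b)).
    + exists (mkposreal a0 (proj1 Hab0)). intros y Hy Hy0.
      unfold ball in Hy; simpl in Hy; unfold AbsRing_ball in Hy; simpl in Hy.
      unfold abs, minus, plus, opp in Hy; simpl in Hy.
      apply Rabs_def2 in Hy. lra.
    + exists b0. intros y Hy; exact Hy.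
    + intros a b Ha Hb. simpl. exists (RInt f a b). split.
      * apply (RInt_correct (V := R_CompleteNormedModule)), Hex; lra.
      * apply HP.
        assert (RInt f a b <= l).
        { apply (proj1 Hl). exists a, b. split; [lra | reflexivity]. }
        assert (RInt f a0 b0 <= RInt f a b).
        { pose proof (RInt_Chasles f a a0 b (Hex a a0 ltac:(lra) ltac:(lra))
            (Hex a0 b ltac:(lra) ltac:(lra))) as H1.
          pose proof (RInt_Chasles f a0 b0 b (Hex a0 b0 ltac:(lra) ltac:(lra))
            (Hex b0 b ltac:(lra) ltac:(lra))) as H2.
          unfold plus in H1, H2; simpl in H1, H2.
          assert (0 <= RInt f a a0).
          { apply RInt_ge_0; [lra | apply Hex; lra | intros; apply Hp; lra]. }
          assert (0 <= RInt f b0 b).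
          { apply RInt_ge_0; [lra | apply Hex; lra | intros; apply Hp; lra]. }
          lra. }
        unfold ball; simpl; unfold AbsRing_ball; simpl.
        unfold abs, minus, plus, opp; simpl.
        apply Rabs_def1; lra.
Qed.

Lemma Gamma_integrand_continuous (x t : R) :
  0 < t -> continuous (fun t => Rpower t (x - 1) * exp (- t)) t.
Proof.
  intros Ht. apply (ex_derive_continuous (V := R_NormedModule)).
  unfold Rpower. auto_derive. exact Ht.
Qed.

Lemma Gamma_integrand_pos (x t : R) : 0 < Rpower t (x - 1) * exp (- t).
Proof. apply Rmult_lt_0_compat; apply exp_pos. Qed.

(** The right side is the value of the left side at its maximum [t = x]; the bound is the tangent
    line inequality for [ln] at [x + 1]. *)
Lemma Rpower_exp_bound (x t : R) : 0 < x -> 0 < t ->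
  Rpower (1 + t) (x + 1) * exp (- t) <= exp ((x + 1) * ln (x + 1) - x).
Proof.
  intros Hx Ht. unfold Rpower. rewrite <- exp_plus.
  assert (Hln : ln (1 + t) - ln (x + 1) <= (1 + t) / (x + 1) - 1).
  { rewrite <- ln_div by lra.
    assert (H : 0 < (1 + t) / (x + 1)) by (apply Rdiv_lt_0_compat; lra).
    pose proof (exp_ineq1_le (ln ((1 + t) / (x + 1)))) as H1.
    rewrite exp_ln in H1 by exact H. lra. }
  apply (Rmult_le_compat_l (x + 1)) in Hln; [ | lra].
  replace ((x + 1) * ((1 + t) / (x + 1) - 1)) with (t - x) in Hln by (field; lra).
  apply exp_le. lra.
Qed.

(* The majorant is the derivative of [C / x * (t / (1 + t)) ^ x], which is
   bounded on the whole half-line. *)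
Lemma Gamma_integral_bounded (x a b : R) : 0 < x -> 0 < a < b ->
  RInt (fun t => Rpower t (x - 1) * exp (- t)) a b
    <= exp ((x + 1) * ln (x + 1) - x) / x.
Proof.
  intros Hx Hab. set (C := exp ((x + 1) * ln (x + 1) - x)).
  set (B := fun t => C / x * Rpower (t / (1 + t)) x).
  set (dB := fun t => C * (Rpower t (x - 1) / Rpower (1 + t) (x + 1))).
  assert (HC : 0 < C) by apply exp_pos.
  assert (HB : is_RInt dB a b (minus (B b) (B a))).
  { apply (is_RInt_derive (V := R_CompleteNormedModule)).
    - intros t Ht. rewrite Rmin_left in Ht by lra.
      assert (0 < t) by lra.
      assert (0 < t / (1 + t)) by (apply Rdiv_lt_0_compat; lra).
      unfold B, dB, Rpower. auto_derive; [repeat split; lra | ].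
      fold (t / (1 + t)). rewrite ln_div by lra.
      replace (exp ((x - 1) * ln t)) with (exp (x * ln t) / t).
      2:{ rewrite <- (exp_ln t) at 2 by lra. unfold Rdiv. rewrite <- exp_Ropp, <- exp_plus.
          f_equal. ring. }
      replace (exp ((x + 1) * ln (1 + t))) with (exp (x * ln (1 + t)) * (1 + t)).
      2:{ rewrite <- (exp_ln (1 + t)) at 2 by lra. rewrite <- exp_plus.
          f_equal. ring. }
      replace (x * (ln t - ln (1 + t))) with (x * ln t + - (x * ln (1 + t))) by ring.
      rewrite exp_plus, exp_Ropp. pose proof (exp_pos (x * ln (1 + t))).
      field. lra.
    - intros t Ht. rewrite Rmin_left in Ht by lra.
      apply (ex_derive_continuous (V := R_NormedModule)).
      unfold dB, Rpower. pose proof (exp_pos ((x + 1) * ln (1 + t))).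
      auto_derive. repeat split; lra. }
  apply Rle_trans with (RInt dB a b).
  - apply RInt_le; [lra | | now exists (minus (B b) (B a)) | ].
    + apply (ex_RInt_continuous (V := R_CompleteNormedModule)). intros z Hz.
      rewrite Rmin_left in Hz by lra. apply Gamma_integrand_continuous. lra.
    + intros t Ht. unfold dB.
      pose proof (Rpower_exp_bound x t Hx ltac:(lra)) as H. fold C in H.
      assert (Hp : 0 < Rpower (1 + t) (x + 1)) by apply exp_pos.
      assert (Hq : 0 < Rpower t (x - 1)) by apply exp_pos.
      replace (C * (Rpower t (x - 1) / Rpower (1 + t) (x + 1)))
        with (Rpower t (x - 1) * (C / Rpower (1 + t) (x + 1))) by (field; lra).
      apply Rmult_le_compat_l; [lra | ].
      apply Rle_div_r; [exact Hp | ]. lra.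
  - rewrite (is_RInt_unique _ _ _ _ HB). unfold minus, plus, opp; simpl. unfold B.
    assert (Rpower (b / (1 + b)) x <= 1).
    { assert (0 < b / (1 + b)) by (apply Rdiv_lt_0_compat; lra).
      assert (b / (1 + b) <= 1) by (apply Rle_div_l; lra).
      apply Rle_trans with (exp 0); [apply exp_le | rewrite exp_0; lra].
      assert (ln (b / (1 + b)) <= 0) by (rewrite <- ln_1; apply ln_le; lra). nra. }
    assert (0 < C / x) by (apply Rdiv_lt_0_compat; lra).
    assert (0 < C / x * Rpower (a / (1 + a)) x)
      by (apply Rmult_lt_0_compat; [assumption | apply exp_pos]).
    nra.
Qed.

Lemma Gamma_spec (x : R) : 0 < x ->
  is_RInt_gen (fun t => Rpower t (x - 1) * exp (- t))
    (at_right 0) (Rbar_locally p_infty) (Gamma x) /\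
  is_lub (fun v => exists a b, 0 < a < b /\
    v = RInt (fun t => Rpower t (x - 1) * exp (- t)) a b) (Gamma x).
Proof.
  intros Hx.
  destruct (RInt_gen_bounded (fun t => Rpower t (x - 1) * exp (- t)) _
    (Gamma_integrand_continuous x)
    (fun t _ => Rlt_le _ _ (Gamma_integrand_pos x t))
    (fun a b => Gamma_integral_bounded x a b Hx)) as (l & Hl & Hlub).
  replace (Gamma x) with l; [now split | ].
  symmetry. now apply is_RInt_gen_unique.
Qed.

Lemma Gamma_pos (x : R) : 0 < x -> 0 < Gamma x.
Proof.
  intros Hx. apply Rlt_le_trans with
    (RInt (fun t => Rpower t (x - 1) * exp (- t)) 1 2).
  - apply RInt_gt_0; [lra | intros; apply Gamma_integrand_pos | ].
    intros t Ht. apply Gamma_integrand_continuous. lra.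
  - apply (proj1 (proj2 (Gamma_spec x Hx))). exists 1, 2. split; [lra | reflexivity].
Qed.

Lemma filterlim_Rpower_exp_0 (x : R) : 0 < x ->
  filterlim (fun t => Rpower t x * exp (- t)) (at_right 0) (locally 0).
Proof.
  intros Hx.
  apply (filterlim_le_le (F := at_right 0) (fun _ => 0) _ (fun t => exp (x * ln t)) 0).
  - exists (mkposreal 1 Rlt_0_1). intros t _ Ht. split.
    + apply Rlt_le, Rmult_lt_0_compat; apply exp_pos.
    + rewrite <- (Rmult_1_r (exp (x * _))). apply Rmult_le_compat_l.
      * apply Rlt_le, exp_pos.
      * rewrite <- exp_0. apply exp_le. lra.
  - apply filterlim_const.
  - eapply filterlim_comp; [ | exact is_lim_exp_m].
    assert (H : filterlim (fun u => x * u) (Rbar_locally m_infty) (Rbar_locally m_infty)).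
    { intros P [M HM]. exists (M / x). intros u Hu. apply HM.
      apply Rlt_div_r in Hu; lra. }
    eapply filterlim_comp; [exact is_lim_ln_0 | exact H].
Qed.

(** The exponent [x + 1] in [Rpower_exp_bound] leaves a spare factor [1 + t], which gives the
    majorant [C / t]. *)
Lemma filterlim_Rpower_exp_infty (x : R) : 0 < x ->
  filterlim (fun t => Rpower t x * exp (- t)) (Rbar_locally p_infty) (locally 0).
Proof.
  intros Hx. set (C := exp ((x + 1) * ln (x + 1) - x)).
  apply (filterlim_le_le (F := Rbar_locally p_infty) (fun _ => 0) _ (fun t => C * / t) 0).
  - exists 0. intros t Ht. split.
    + apply Rlt_le, Rmult_lt_0_compat; apply exp_pos.
    + pose proof (Rpower_exp_bound x t Hx Ht) as H. fold C in H.
      rewrite Rpower_plus, Rpower_1 in H by lra.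
      apply (Rle_div_r _ C t Ht).
      apply Rle_trans with (2 := H).
      assert (Rpower t x <= Rpower (1 + t) x) by (apply Rle_Rpower_l; lra).
      assert (0 < Rpower t x) by apply exp_pos.
      assert (0 < exp (- t)) by apply exp_pos.
      rewrite (Rmult_assoc _ (exp (- t))), (Rmult_comm (exp (- t))), <- Rmult_assoc.
      apply Rmult_le_compat_r; [lra | ]. nra.
  - apply filterlim_const.
  - pose proof (is_lim_scal_l Rinv C p_infty 0 (is_lim_inv _ _ _ (is_lim_id p_infty) ltac:(discriminate))) as H.
    simpl in H. rewrite Rmult_0_r in H. exact H.
Qed.

(** Integration by parts: [h] vanishes at both ends, so its derivative [dh] integrates to 0. *)
Lemma Gamma_succ (x : R) : 0 < x -> Gamma (x + 1) = x * Gamma x.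
Proof.
  intros Hx.
  set (h := fun t => Rpower t x * exp (- t)).
  set (dh := fun t => x * (Rpower t (x - 1) * exp (- t)) - Rpower t x * exp (- t)).
  assert (Hd : forall t, 0 < t -> is_derive h t (dh t)).
  { intros t Ht. unfold h, dh.
    replace (Rpower t x) with (Rpower t (x - 1) * t).
    2:{ rewrite <- (Rpower_1 t) at 2 by exact Ht. rewrite <- Rpower_plus.
        f_equal. ring. }
    unfold Rpower. auto_derive; [exact Ht | ].
    replace (x * ln t) with ((x - 1) * ln t + ln t) by ring.
    rewrite exp_plus, exp_ln by exact Ht. field. lra. }
  assert (Hpos : filter_prod (at_right 0) (Rbar_locally p_infty)
    (fun ab => 0 < fst ab < snd ab)).
  { apply (Filter_prod _ _ _ (fun a => 0 < a < 1) (fun b => 1 < b)).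
    - exists (mkposreal 1 Rlt_0_1). intros y Hy Hy0.
      unfold ball in Hy; simpl in Hy; unfold AbsRing_ball in Hy; simpl in Hy.
      unfold abs, minus, plus, opp in Hy; simpl in Hy.
      apply Rabs_def2 in Hy. lra.
    - exists 1. now intros.
    - intros a b Ha Hb; simpl; lra. }
  assert (HI : is_RInt_gen (Derive h) (at_right 0) (Rbar_locally p_infty) (0 - 0)).
  { apply is_RInt_gen_Derive.
    - revert Hpos. apply filter_imp. intros [a b] Hab t Ht; simpl in *.
      rewrite Rmin_left in Ht by lra. exists (dh t). apply Hd. lra.
    - revert Hpos. apply filter_imp. intros [a b] Hab t Ht; simpl in *.
      rewrite Rmin_left in Ht by lra.
      apply continuous_ext_loc with dh.
      + exists (mkposreal t ltac:(lra)). intros y Hy.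
        unfold ball in Hy; simpl in Hy; unfold AbsRing_ball in Hy; simpl in Hy.
        unfold abs, minus, plus, opp in Hy; simpl in Hy.
        apply Rabs_def2 in Hy. symmetry. apply is_derive_unique, Hd. lra.
      + apply (ex_derive_continuous (V := R_NormedModule)).
        unfold dh, Rpower. auto_derive. lra.
    - now apply filterlim_Rpower_exp_0.
    - now apply filterlim_Rpower_exp_infty. }
  (* The integrand of [Gamma (x + 1)] is [x] times that of [Gamma x], minus [dh]. *)
  pose proof (is_RInt_gen_plus _ _ _ _
    (is_RInt_gen_scal _ x _ (proj1 (Gamma_spec x Hx)))
    (is_RInt_gen_scal _ (-1) _ HI)) as H.
  unfold Gamma at 1.
  apply is_RInt_gen_unique.
  replace (x * Gamma x) with (plus (scal x (Gamma x)) (scal (-1) (0 - 0))).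
  2:{ unfold plus, scal; simpl; unfold mult; simpl. ring. }
  revert H. apply is_RInt_gen_ext.
  revert Hpos. apply filter_imp. intros [a b] Hab t Ht; simpl in *.
  rewrite Rmin_left in Ht by lra.
  rewrite (is_derive_unique _ _ _ (Hd t ltac:(lra))).
  unfold plus, scal, dh; simpl; unfold mult; simpl.
  replace (x + 1 - 1) with x by ring. ring.
Qed.

(** Both values lie above the tangent line at the weighted mean [m], and the linear terms cancel in
    the average. *)
Lemma exp_convex (l u v : R) : 0 <= l <= 1 ->
  exp (l * u + (1 - l) * v) <= l * exp u + (1 - l) * exp v.
Proof.
  intros Hl. set (m := l * u + (1 - l) * v).
  replace (exp u) with (exp m * exp (u - m)) by (rewrite <- exp_plus; f_equal; ring).
  replace (exp v) with (exp m * exp (v - m)) by (rewrite <- exp_plus; f_equal; ring).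
  pose proof (exp_ineq1_le (u - m)). pose proof (exp_ineq1_le (v - m)).
  assert (1 <= l * exp (u - m) + (1 - l) * exp (v - m)).
  { assert (l * (1 + (u - m)) <= l * exp (u - m)) by (apply Rmult_le_compat_l; lra).
    assert ((1 - l) * (1 + (v - m)) <= (1 - l) * exp (v - m))
      by (apply Rmult_le_compat_l; lra).
    unfold m in *. lra. }
  pose proof (exp_pos m). nra.
Qed.

(** Hölder's inequality, proved by applying convexity of [exp] pointwise to the integrands divided
    by [Gamma x] and [Gamma y]. As [Gamma z] is a supremum, it suffices to bound the integrals over
    compact intervals. *)
Lemma ln_Gamma_convex (l x y : R) : 0 <= l <= 1 -> 0 < x -> 0 < y ->
  ln (Gamma (l * x + (1 - l) * y)) <= l * ln (Gamma x) + (1 - l) * ln (Gamma y).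
Proof.
  intros Hl Hx Hy. set (z := l * x + (1 - l) * y).
  assert (Hz : 0 < z) by (unfold z; nra).
  set (K := l * ln (Gamma x) + (1 - l) * ln (Gamma y)).
  pose proof (Gamma_pos x Hx) as Gx. pose proof (Gamma_pos y Hy) as Gy.
  rewrite <- (ln_exp K). apply ln_le; [now apply Gamma_pos | ].
  apply (proj2 (proj2 (Gamma_spec z Hz))). intros v (a & b & Hab & ->).
  assert (Hex : forall w, ex_RInt (fun t => Rpower t (w - 1) * exp (- t)) a b).
  { intros w. apply (ex_RInt_continuous (V := R_CompleteNormedModule)). intros t Ht.
    rewrite Rmin_left in Ht by lra. apply Gamma_integrand_continuous. lra. }
  (* The weights are chosen so that [p * Gamma x + q * Gamma y = exp K]. *)
  set (p := exp K * l / Gamma x). set (q := exp K * (1 - l) / Gamma y).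
  pose proof (is_RInt_plus _ _ _ _ _ _
    (is_RInt_scal _ _ _ p _ (RInt_correct (V := R_CompleteNormedModule) _ _ _ (Hex x)))
    (is_RInt_scal _ _ _ q _ (RInt_correct (V := R_CompleteNormedModule) _ _ _ (Hex y))))
    as HI.
  assert (Hxy : forall w, 0 < w ->
    RInt (fun t => Rpower t (w - 1) * exp (- t)) a b <= Gamma w).
  { intros w Hw. apply (proj1 (proj2 (Gamma_spec w Hw))). now exists a, b. }
  pose proof (exp_pos K) as HK.
  assert (Hp : 0 <= p) by (apply Rdiv_le_0_compat; nra).
  assert (Hq : 0 <= q) by (apply Rdiv_le_0_compat; nra).
  eapply Rle_trans.
  - apply (is_RInt_le _ _ a b _ _ ltac:(lra)
      (RInt_correct (V := R_CompleteNormedModule) _ _ _ (Hex z)) HI).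
    intros t Ht. unfold plus, scal; simpl; unfold mult; simpl.
    pose proof (exp_convex l ((x - 1) * ln t - t - ln (Gamma x))
      ((y - 1) * ln t - t - ln (Gamma y)) Hl) as H.
    apply (Rmult_le_compat_l (exp K)) in H; [ | lra].
    rewrite <- exp_plus in H. unfold Rpower. rewrite <- !exp_plus.
    replace (K + _) with ((z - 1) * ln t + - t) in H by (unfold K, z; ring).
    apply Rle_trans with (1 := H). right.
    assert (E : forall w, 0 < Gamma w -> exp ((w - 1) * ln t - t - ln (Gamma w)) =
      exp ((w - 1) * ln t + - t) / Gamma w).
    { intros w Hw. unfold Rminus at 1. rewrite exp_plus, exp_Ropp, exp_ln by exact Hw.
      reflexivity. }
    rewrite !E by assumption. unfold p, q. field. lra.
  - unfold plus, scal; simpl; unfold mult; simpl.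
    apply Rle_trans with (p * Gamma x + q * Gamma y).
    + apply Rplus_le_compat; apply Rmult_le_compat_l; auto.
    + right. unfold p, q. field. lra.
Qed.

(** * Hurwitz zeta and digamma series *)

Lemma ex_series_Rmult_l (c : R) (a : nat -> R) :
  ex_series a -> ex_series (fun k => c * a k).
Proof. exact (ex_series_scal_l (V := R_NormedModule) c a). Qed.

Lemma series_telescope_le (a u : nat -> R) :
  (forall k, 0 <= a k <= u k - u (S k)) -> (forall k, 0 <= u k) ->
  ex_series a /\ Series a <= u O.
Proof.
  intros Ha Hu.
  assert (Hs : forall n, sum_n a n <= u O - u (S n)).
  { induction n as [ | n IH].
    - rewrite sum_O. apply Ha.
    - rewrite sum_Sn. unfold plus; simpl. specialize (Ha (S n)). lra. }
  destruct (ex_finite_lim_seq_incr (sum_n a) (u O)) as [l Hl].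
  - intros n. rewrite sum_Sn. unfold plus; simpl. specialize (Ha (S n)). lra.
  - intros n. specialize (Hs n). specialize (Hu (S n)). lra.
  - assert (Hser : is_series a l) by exact Hl.
    split; [now exists l | ]. rewrite (is_series_unique _ _ Hser).
    apply (is_lim_seq_le (sum_n a) (fun _ => u O) l (u O)); auto using is_lim_seq_const.
    intros n. specialize (Hs n). specialize (Hu (S n)). lra.
Qed.

Lemma is_series_telescope (u : nat -> R) :
  is_lim_seq u 0 -> is_series (fun k => u k - u (S k)) (u O).
Proof.
  intros Hu. change (is_lim_seq (sum_n (fun k => u k - u (S k))) (u O)).
  apply is_lim_seq_ext with (fun n => u O - u (S n)).
  - induction n as [ | n IH]; [now rewrite sum_O | ].
    rewrite sum_Sn, <- IH. unfold plus; simpl. ring.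
  - apply is_lim_seq_incr_1 in Hu.
    pose proof (is_lim_seq_minus' _ _ _ _ (is_lim_seq_const (u O)) Hu) as H.
    now rewrite Rminus_0_r in H.
Qed.

(** A summable bound [M] on the second derivatives bounds the first-order Taylor remainders by
    [M k * d ^ 2]; their sum is [O(d ^ 2)], which gives the derivative of the series. *)
Lemma is_derive_Series (f g h : nat -> R -> R) (M : nat -> R) (a x : R) :
  a < x ->
  (forall k y, a <= y -> is_derive (f k) y (g k y)) ->
  (forall k y, a <= y -> is_derive (g k) y (h k y)) ->
  (forall k y, a <= y -> Rabs (h k y) <= M k) ->
  ex_series M ->
  (forall y, a <= y -> ex_series (fun k => f k y)) ->
  ex_series (fun k => g k x) ->
  is_derive (fun y => Series (fun k => f k y)) x (Series (fun k => g k x)).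
Proof.
  intros Hax Hf Hg Hh HM Hsf Hsg.
  assert (HM0 : forall k, 0 <= M k).
  { intros k. apply Rle_trans with (2 := Hh k x ltac:(lra)). apply Rabs_pos. }
  (* The mean value inequality is used twice: on the remainder, whose derivative is [g k t - g k x],
     and on [g k] to bound that derivative. *)
  assert (Htaylor : forall k d, Rabs d <= x - a ->
    Rabs (f k (x + d) - f k x - g k x * d) <= M k * (d * d)).
  { intros k d Hd.
    pose proof (bounded_variation (fun y => f k y - g k x * y)
      (fun y => g k y - g k x) (M k * Rabs d) x (x + d)) as H.
    replace (x + d - x) with d in H by ring.
    replace (f k (x + d) - f k x - g k x * d)
      with (f k (x + d) - g k x * (x + d) - (f k x - g k x * x)) by ring.
    replace (M k * (d * d)) with (M k * Rabs d * Rabs d).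
    2:{ rewrite Rmult_assoc. f_equal. unfold Rabs. destruct Rcase_abs; ring. }
    apply H. intros t Ht.
    assert (a <= t) by (apply Rabs_le_between in Ht; lra). split.
    - apply (is_derive_minus (V := R_NormedModule)); [now apply Hf | ].
      auto_derive; [exact I | ring].
    - apply Rle_trans with (M k * Rabs (t - x)); [ | now apply Rmult_le_compat_l].
      apply (bounded_variation (g k) (h k)). intros s Hs.
      assert (a <= s) by (apply Rabs_le_between in Hs; lra).
      split; [now apply Hg | now apply Hh]. }
  assert (HS : 0 <= Series M).
  (* Terms [0 * 0] let [Series_scal_l] evaluate the zero series. *)
  { replace 0 with (Series (fun _ : nat => 0 * 0)).
    - apply Series_le; [ | exact HM]. intros k. split; [lra | ].
      rewrite Rmult_0_l. apply HM0.
    - rewrite Series_scal_l. ring. }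
  apply is_derive_Reals. intros eps Heps.
  (* The first bound keeps [x + d] above [a]; the second makes [Series M * Rabs d < eps], the [+ 1]
     keeping the denominator positive. *)
  assert (Hdelta : 0 < Rmin (x - a) (eps / (Series M + 1))).
  { apply Rmin_pos; [lra | apply Rdiv_lt_0_compat; lra]. }
  exists (mkposreal _ Hdelta). simpl. intros d Hd0 Hd.
  assert (Hd1 : Rabs d <= x - a) by (pose proof (Rmin_l (x - a) (eps / (Series M + 1))); lra).
  assert (Hd2 : Rabs d < eps / (Series M + 1))
    by (pose proof (Rmin_r (x - a) (eps / (Series M + 1))); lra).
  assert (Hxd : a <= x + d) by (apply Rabs_le_between in Hd1; lra).
  assert (Hrem : Rabs (Series (fun k => f k (x + d)) - Series (fun k => f k x)
    - Series (fun k => g k x) * d) <= Series M * (d * d)).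
  { rewrite <- Series_scal_r, <- Series_minus; [ | now apply Hsf | apply Hsf; lra].
    rewrite <- Series_minus, <- Series_scal_r.
    - eapply Rle_trans; [apply Series_Rabs | apply Series_le].
      + apply (ex_series_le (V := R_CompleteNormedModule) _ (fun k => M k * (d * d))).
        * intros k. unfold norm; simpl; unfold abs; simpl. rewrite Rabs_Rabsolu.
          now apply Htaylor.
        * now apply ex_series_scal_r.
      + intros k. split; [apply Rabs_pos | now apply Htaylor].
      + now apply ex_series_scal_r.
    - apply (ex_series_minus (V := R_NormedModule)); [now apply Hsf | apply Hsf; lra].
    - now apply ex_series_scal_r. }
  replace (_ / d - _) with ((Series (fun k => f k (x + d)) - Series (fun k => f k x)
    - Series (fun k => g k x) * d) / d) by (now field).
  rewrite Rabs_div by exact Hd0.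
  assert (Hdp : 0 < Rabs d) by now apply Rabs_pos_lt.
  apply Rlt_div_l; [exact Hdp | ].
  apply Rle_lt_trans with (1 := Hrem).
  replace (d * d) with (Rabs d * Rabs d) by (unfold Rabs; destruct Rcase_abs; ring).
  rewrite <- Rmult_assoc. apply Rmult_lt_compat_r; [exact Hdp | ].
  apply Rlt_div_r in Hd2; nra.
Qed.

(** The Hurwitz zeta function at an integer exponent. The series converges from exponent 2 on, hence
    the exponents [m + 2] below. *)
Definition hurwitz (m : nat) (x : R) : R := Series (fun k => / (x + INR k) ^ m).

Lemma ex_series_hurwitz (m : nat) (x : R) : 0 < x ->
  ex_series (fun k => / (x + INR k) ^ (m + 2)).
Proof.
  intros Hx.
  assert (Hk : forall k, 0 < x + INR k) by (intros k; pose proof (pos_INR k); lra).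
  assert (H2 : ex_series (fun k => / (x + INR k) ^ 2)).
  { apply ex_series_incr_1.
    apply (series_telescope_le _ (fun k => / (x + INR k))).
    - intros k. specialize (Hk k). rewrite S_INR. set (s := x + INR k) in *.
      replace (x + (INR k + 1)) with (s + 1) by (unfold s; ring). split.
      + apply Rlt_le, Rinv_0_lt_compat, pow_lt. lra.
      + replace (/ s - / (s + 1)) with (/ (s * (s + 1))) by (field; lra).
        apply Rinv_le_contravar; nra.
    - intros k. apply Rlt_le, Rinv_0_lt_compat, Hk. }
  apply (ex_series_le (V := R_CompleteNormedModule) _ (fun k => / x ^ m * / (x + INR k) ^ 2)).
  - intros k. unfold norm; simpl; unfold abs; simpl.
    change ((x + INR k) * ((x + INR k) * 1)) with ((x + INR k) ^ 2).
    rewrite Rabs_pos_eq by (apply Rlt_le, Rinv_0_lt_compat, pow_lt, Hk).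
    rewrite pow_add, Rinv_mult. apply Rmult_le_compat_r.
    + apply Rlt_le, Rinv_0_lt_compat, pow_lt, Hk.
    + apply Rinv_le_contravar; [now apply pow_lt | ].
      apply pow_incr. pose proof (pos_INR k). lra.
  - now apply ex_series_Rmult_l.
Qed.

Lemma is_derive_inv_pow (m : nat) (b x : R) : 0 < x + b ->
  is_derive (fun y => / (y + b) ^ m) x (- INR m * / (x + b) ^ (m + 1)).
Proof.
  intros H. assert (H' := pow_lt _ m H).
  auto_derive; [lra | ].
  destruct m as [ | m]; [simpl; field; lra | ].
  rewrite pow_add. simpl pred. simpl pow. simpl pow in H'. field.
  split; [lra | ]. pose proof (pow_lt _ m H). lra.
Qed.

Lemma inv_pow_le (m : nat) (a k y : R) : 0 <= k -> 0 < a <= y ->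
  0 < / (y + k) ^ m <= / (a + k) ^ m.
Proof.
  intros Hk Ha. split; [apply Rinv_0_lt_compat, pow_lt; lra | ].
  apply Rinv_le_contravar; [apply pow_lt; lra | apply pow_incr; lra].
Qed.

Lemma is_derive_hurwitz (m : nat) (x : R) : 0 < x ->
  is_derive (hurwitz (m + 2)) x (- INR (m + 2) * hurwitz (m + 3) x).
Proof.
  intros Hx. unfold hurwitz. rewrite <- Series_scal_l.
  assert (Hk : forall k y, x / 2 <= y -> 0 < y + INR k)
    by (intros k y Hy; pose proof (pos_INR k); lra).
  replace (m + 3)%nat with (m + 2 + 1)%nat by lia.
  (* On the half-line from [x / 2] the second derivatives are largest at [x / 2], where they form a
     convergent Hurwitz series. *)
  apply (is_derive_Series (fun k y => / (y + INR k) ^ (m + 2))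
    (fun k y => - INR (m + 2) * / (y + INR k) ^ (m + 2 + 1))
    (fun k y => INR (m + 2) * INR (m + 3) * / (y + INR k) ^ (m + 2 + 2))
    (fun k => INR (m + 2) * INR (m + 3) * / (x / 2 + INR k) ^ (m + 2 + 2)) (x / 2)).
  - lra.
  - intros k y Hy. now apply is_derive_inv_pow, Hk.
  - intros k y Hy.
    replace (INR (m + 2) * INR (m + 3) * / (y + INR k) ^ (m + 2 + 2))
      with (- INR (m + 2) * (- INR (m + 2 + 1) * / (y + INR k) ^ (m + 2 + 1 + 1))).
    + apply is_derive_scal. now apply is_derive_inv_pow, Hk.
    + replace (m + 2 + 1)%nat with (m + 3)%nat by lia.
      replace (m + 3 + 1)%nat with (m + 2 + 2)%nat by lia. ring.
  - intros k y Hy.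
    pose proof (inv_pow_le (m + 2 + 2) (x / 2) (INR k) y (pos_INR k) ltac:(lra)).
    pose proof (Rmult_le_pos _ _ (pos_INR (m + 2)) (pos_INR (m + 3))).
    rewrite Rabs_pos_eq by (apply Rmult_le_pos; lra).
    apply Rmult_le_compat_l; lra.
  - apply ex_series_Rmult_l, ex_series_hurwitz. lra.
  - intros y Hy. apply ex_series_hurwitz. lra.
  - apply ex_series_Rmult_l.
    replace (m + 2 + 1)%nat with (m + 1 + 2)%nat by lia. now apply ex_series_hurwitz.
Qed.

(** The midpoint rule for [s ^ - (n + 1)] on [[m - h, m + h]], in integrated form. Multiplied by
    [m ^ n] it reads [2 * n * h / m <= p ^ n - q ^ n], which follows by induction on the exponent
    from [p * q >= 1]. *)
Lemma inv_pow_midpoint (n : nat) (m h : R) : 0 < h < m ->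
  2 * h * INR n * / m ^ (n + 1) <= / (m - h) ^ n - / (m + h) ^ n.
Proof.
  intros Hh. set (p := m / (m - h)). set (q := m / (m + h)).
  assert (Hpos : 0 < (m - h) * (m + h)) by nra.
  assert (Hpq : 1 <= p * q).
  { replace (p * q) with (m * m / ((m - h) * (m + h))) by (unfold p, q; field; lra).
    apply Rle_div_r; nra. }
  assert (Hq : 0 < q) by (apply Rdiv_lt_0_compat; lra).
  assert (Hp : 0 < p) by (apply Rdiv_lt_0_compat; lra).
  assert (Hd : 2 * (h / m) <= p - q).
  { replace (p - q) with (2 * (h / m) * (p * q)) by (unfold p, q; field; lra).
    assert (0 < h / m) by (apply Rdiv_lt_0_compat; lra). nra. }
  assert (Hhm : 0 < h / m) by (apply Rdiv_lt_0_compat; lra).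
  (* The arithmetic-geometric mean inequality, with [p ^ k * q ^ k >= 1]. *)
  assert (Hsum : forall k, 2 <= p ^ k + q ^ k).
  { intros k. assert (1 <= p ^ k * q ^ k) by (rewrite <- Rpow_mult_distr; now apply pow_R1_Rle).
    pose proof (pow_lt p k Hp). pose proof (pow_lt q k Hq).
    pose proof (Rle_0_sqr (p ^ k - q ^ k)). unfold Rsqr in *. nra. }
  assert (Hmain : forall k, 2 * INR k * (h / m) <= p ^ k - q ^ k).
  { induction k as [ | k IH]; [simpl; lra | ].
    rewrite S_INR. pose proof (Hsum k) as H1. pose proof (Hsum 1%nat) as H2.
    simpl in H2. rewrite !Rmult_1_r in H2.
    replace (p ^ S k - q ^ S k)
      with (((p + q) * (p ^ k - q ^ k) + (p - q) * (p ^ k + q ^ k)) / 2) by (simpl; field).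
    pose proof (pos_INR k).
    assert (2 * (p ^ k - q ^ k) <= (p + q) * (p ^ k - q ^ k))
      by (apply Rmult_le_compat_r; nra).
    assert (2 * (h / m) * 2 <= (p - q) * (p ^ k + q ^ k))
      by (apply Rmult_le_compat; lra).
    lra. }
  specialize (Hmain n). unfold p, q, Rdiv in Hmain.
  rewrite !Rpow_mult_distr, !pow_inv in Hmain.
  assert (Hm : 0 < m ^ n) by (apply pow_lt; lra).
  rewrite pow_add, pow_1.
  apply Rmult_le_reg_l with (m ^ n); [exact Hm | ].
  replace (m ^ n * (2 * h * INR n * / (m ^ n * m)))
    with (2 * INR n * (h * / m)) by (field; lra).
  lra.
Qed.

(* The midpoint rule compares each term with the increment of
   [- 1 / ((m + 1) s ^ (m + 1))] over a unit interval, and the increments telescope. *)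
Lemma hurwitz_le (m : nat) (x b : R) : 0 < x -> 1 / 2 <= b ->
  INR (m + 1) * hurwitz (m + 2) (x + b) <= / x ^ (m + 1).
Proof.
  intros Hx Hb. unfold hurwitz. rewrite <- Series_scal_l.
  replace (/ x ^ (m + 1)) with (/ (x + INR 0) ^ (m + 1)) by (simpl INR; now rewrite Rplus_0_r).
  apply (series_telescope_le _ (fun k => / (x + INR k) ^ (m + 1))).
  - intros k. pose proof (pos_INR k).
    (* This is where [b >= 1/2] enters: [x + k + b] is at least the midpoint of
       [[x + k, x + k + 1]]. *)
    pose proof (inv_pow_le (m + 2) (x + 1 / 2) (INR k) (x + b) ltac:(lra) ltac:(lra)) as H1.
    pose proof (inv_pow_midpoint (m + 1) (x + 1 / 2 + INR k) (1 / 2) ltac:(lra)) as H2.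
    replace (m + 1 + 1)%nat with (m + 2)%nat in H2 by lia.
    replace (x + 1 / 2 + INR k - 1 / 2) with (x + INR k) in H2 by ring.
    replace (x + 1 / 2 + INR k + 1 / 2) with (x + INR (S k)) in H2
      by (rewrite S_INR; field).
    pose proof (pos_INR (m + 1)) as H3. split; [apply Rmult_le_pos; lra | ].
    apply Rle_trans with (2 := H2).
    replace (2 * (1 / 2) * INR (m + 1)) with (INR (m + 1)) by field.
    now apply Rmult_le_compat_l.
  - intros k. apply Rlt_le, Rinv_0_lt_compat, pow_lt. pose proof (pos_INR k). lra.
Qed.

(** The digamma function plus Euler's constant. *)
Definition digamma_series (x : R) : R :=
  Series (fun k => / (1 + INR k) - / (x + INR k)).

Lemma ex_series_digamma (x : R) : 0 < x ->
  ex_series (fun k => / (1 + INR k) - / (x + INR k)).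
Proof.
  intros Hx. set (c := Rmin 1 x).
  assert (Hc : 0 < c) by (apply Rmin_pos; lra).
  (* The general term equals [(x - 1) / ((1 + k) * (x + k))], and both factors of the denominator
     are at least [c + k]. *)
  apply (ex_series_le (V := R_CompleteNormedModule) _
    (fun k => Rabs (x - 1) * / (c + INR k) ^ (0 + 2))).
  - intros k. unfold norm; simpl; unfold abs; simpl. pose proof (pos_INR k).
    replace (/ (1 + INR k) - / (x + INR k))
      with ((x - 1) * / ((1 + INR k) * (x + INR k))) by (field; lra).
    rewrite Rabs_mult. apply Rmult_le_compat_l; [apply Rabs_pos | ].
    rewrite Rabs_pos_eq by (apply Rlt_le, Rinv_0_lt_compat; nra).
    assert (c <= 1) by apply Rmin_l. assert (c <= x) by apply Rmin_r.
    apply Rinv_le_contravar; [nra | ].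
    rewrite Rmult_1_r. apply Rmult_le_compat; lra.
  - apply ex_series_Rmult_l, ex_series_hurwitz, Hc.
Qed.

Lemma is_derive_digamma_series (x : R) : 0 < x ->
  is_derive digamma_series x (hurwitz 2 x).
Proof.
  intros Hx. unfold digamma_series, hurwitz.
  assert (Hk : forall k y, x / 2 <= y -> 0 < y + INR k)
    by (intros k y Hy; pose proof (pos_INR k); lra).
  apply (is_derive_Series (fun k y => / (1 + INR k) - / (y + INR k))
    (fun k y => / (y + INR k) ^ 2)
    (fun k y => - INR 2 * / (y + INR k) ^ (2 + 1))
    (fun k => INR 2 * / (x / 2 + INR k) ^ (1 + 2)) (x / 2)).
  - lra.
  - intros k y Hy. specialize (Hk k y Hy). auto_derive; [lra | field; lra].
  - intros k y Hy. now apply is_derive_inv_pow, Hk.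
  - intros k y Hy.
    pose proof (inv_pow_le 3 (x / 2) (INR k) y (pos_INR k) ltac:(lra)).
    rewrite Rabs_mult, Rabs_Ropp, !Rabs_pos_eq by (try apply pos_INR; simpl Nat.add; lra).
    apply Rmult_le_compat_l; [apply pos_INR | simpl Nat.add; lra].
  - apply ex_series_Rmult_l, ex_series_hurwitz. lra.
  - intros y Hy. apply ex_series_digamma. lra.
  - now apply (ex_series_hurwitz 0).
Qed.

Lemma digamma_series_succ (x : R) : 0 < x ->
  digamma_series (x + 1) = digamma_series x + / x.
Proof.
  intros Hx.
  assert (H : digamma_series (x + 1) - digamma_series x = / x); [ | lra].
  unfold digamma_series. rewrite <- Series_minus by (apply ex_series_digamma; lra).
  replace (/ x) with (/ (x + INR 0)) by (simpl; now rewrite Rplus_0_r).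
  apply is_series_unique.
  apply (is_series_ext (fun k => / (x + INR k) - / (x + INR (S k))));
    [ | apply (is_series_telescope (fun k => / (x + INR k)))].
  - intros k. rewrite S_INR. replace (x + 1 + INR k) with (x + (INR k + 1)) by ring.
    simpl. ring.
  - replace (Finite 0) with (Rbar_inv p_infty) by reflexivity.
    apply is_lim_seq_inv; [ | discriminate].
    eapply is_lim_seq_plus; [apply is_lim_seq_const | apply is_lim_seq_INR | reflexivity].
Qed.

(** * Identification of [ln Gamma] *)

Lemma ln_sub_le (a b : R) : 0 < a -> 0 < b -> ln b - ln a <= (b - a) / a.
Proof.
  intros Ha Hb. rewrite <- ln_div by assumption.
  assert (H : 0 < b / a) by now apply Rdiv_lt_0_compat.
  pose proof (exp_ineq1_le (ln (b / a))) as H1. rewrite exp_ln in H1 by exact H.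
  replace ((b - a) / a) with (b / a - 1) by (field; lra). lra.
Qed.

Lemma locally_pos (x : R) : 0 < x -> locally x (fun y => 0 < y).
Proof. intros Hx. exact (open_gt 0 x Hx). Qed.

(** This stands in for convexity in the Bohr-Mollerup argument. Convexity would give the sharper
    upper bound [s * ln y]; the form with [ln (y + 1)] is the one read off directly from
    [psi (y + 1) <= ln (y + 1)]. *)
Definition log_increments (F : R -> R) : Prop :=
  (forall x, 0 < x -> F (x + 1) = F x + ln x) /\
  (forall y s, 1 < y -> 0 <= s <= 1 ->
    s * ln (y - 1) <= F (y + s) - F y <= s * ln (y + 1)).

(* Bohr-Mollerup: [F - G] is 1-periodic, and its variation over [[y, y + 1]]
   is at most [ln (y + 1) - ln (y - 1)], which vanishes at infinity. *)
Lemma log_increments_unique (F G : R -> R) :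
  log_increments F -> log_increments G ->
  forall x y, 0 < x -> 0 < y -> F x - G x = F y - G y.
Proof.
  intros [HF1 HF2] [HG1 HG2].
  assert (Hper : forall n y, 0 < y -> F (y + INR n) - G (y + INR n) = F y - G y).
  { intros n y Hy. induction n as [ | n IH]; [simpl; now rewrite Rplus_0_r | ].
    rewrite S_INR, <- Rplus_assoc. pose proof (pos_INR n).
    rewrite HF1, HG1 by lra. lra. }
  assert (Hloc : forall y s, 0 < y -> 0 <= s <= 1 -> F (y + s) - G (y + s) = F y - G y).
  { intros y s Hy Hs. set (d := F (y + s) - G (y + s) - (F y - G y)).
    (* By periodicity [d] may be computed at [z = y + N + 1], where both increments lie in an
       interval of length at most [2 / (z - 1)], and [z - 1 >= N]. As [N] is arbitrary, [d = 0]. *)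
    assert (Hd : forall N, INR N * Rabs d <= 2).
    { intros N. pose proof (pos_INR N).
      set (z := y + INR (S N)). pose proof (S_INR N) as HN.
      destruct (HF2 z s ltac:(unfold z; lra) Hs) as [F1 F2].
      destruct (HG2 z s ltac:(unfold z; lra) Hs) as [G1 G2].
      pose proof (Hper (S N) y Hy) as P1. fold z in P1.
      pose proof (Hper (S N) (y + s) ltac:(lra)) as P2.
      replace (y + s + INR (S N)) with (z + s) in P2 by (unfold z; ring).
      pose proof (ln_sub_le (z - 1) (z + 1) ltac:(unfold z; lra) ltac:(unfold z; lra)) as L.
      replace (z + 1 - (z - 1)) with 2 in L by ring.
      assert (Hlog : 0 <= ln (z + 1) - ln (z - 1)).
      { assert (ln (z - 1) <= ln (z + 1)) by (apply ln_le; unfold z; lra). lra. }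
      assert (Habs : Rabs d <= 2 / (z - 1)).
      { apply Rabs_le. unfold d. split; nra. }
      apply Rle_div_r in Habs; [ | unfold z; lra].
      pose proof (Rabs_pos d). unfold z in Habs. nra. }
    destruct (Req_dec d 0) as [H0 | H0]; [unfold d in H0; lra | ].
    exfalso. pose proof (Rabs_pos_lt _ H0) as Hpos.
    destruct (INR_unbounded (2 / Rabs d)) as [N HN].
    apply Rlt_div_l in HN; [ | exact Hpos]. specialize (Hd N). lra. }
  assert (Hglob : forall n y s, 0 < y -> 0 <= s <= INR n ->
    F (y + s) - G (y + s) = F y - G y).
  { induction n as [ | n IH]; intros y s Hy Hs.
    - simpl in Hs. replace s with 0 by lra. now rewrite Rplus_0_r.
    - rewrite S_INR in Hs. destruct (Rle_dec s 1) as [H | H].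
      + apply Hloc; lra.
      + replace (y + s) with (y + 1 + (s - 1)) by ring.
        rewrite IH by lra. apply Hloc; lra. }
  assert (Hle : forall x y, 0 < x <= y -> F y - G y = F x - G x).
  { intros x y Hxy. destruct (INR_unbounded (y - x)) as [N HN].
    replace y with (x + (y - x)) by ring. apply (Hglob N); lra. }
  intros x y Hx Hy. destruct (Rle_dec x y); [symmetry | ]; apply Hle; lra.
Qed.

Lemma ln_Gamma_log_increments : log_increments (fun x => ln (Gamma x)).
Proof.
  assert (Hsucc : forall x, 0 < x -> ln (Gamma (x + 1)) = ln (Gamma x) + ln x).
  { intros x Hx. rewrite Gamma_succ by exact Hx.
    rewrite ln_mult by (try apply Gamma_pos; exact Hx). ring. }
  split; [exact Hsucc | ].
  intros y s Hy Hs. split.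
  - pose proof (Hsucc (y - 1) ltac:(lra)) as H1.
    replace (y - 1 + 1) with y in H1 by ring.
    (* With this weight [y] is the convex combination of [y - 1] and [y + s], so the slope on
       [[y - 1, y]] bounds that on [[y, y + s]] from below. *)
    assert (Hl : 0 <= s / (1 + s) <= 1).
    { split; [apply Rdiv_le_0_compat; lra | apply Rle_div_l; lra]. }
    pose proof (ln_Gamma_convex (s / (1 + s)) (y - 1) (y + s) Hl ltac:(lra) ltac:(lra)) as H.
    replace (s / (1 + s) * (y - 1) + _) with y in H by (field; lra).
    apply (Rmult_le_compat_l (1 + s)) in H; [ | lra].
    replace ((1 + s) * (s / (1 + s) * ln (Gamma (y - 1)) + (1 - s / (1 + s)) * ln (Gamma (y + s))))
      with (s * ln (Gamma (y - 1)) + ln (Gamma (y + s))) in H by (field; lra).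
    nra.
  - pose proof (ln_Gamma_convex (1 - s) y (y + 1) ltac:(lra) ltac:(lra) ltac:(lra)) as H.
    replace ((1 - s) * y + (1 - (1 - s)) * (y + 1)) with (y + s) in H by ring.
    rewrite Hsucc in H by lra.
    assert (ln y <= ln (y + 1)) by (apply ln_le; lra). nra.
Qed.

Lemma hurwitz_2_pos (x : R) : 0 < x -> 0 <= hurwitz 2 x.
Proof.
  intros Hx. unfold hurwitz.
  replace 0 with (Series (fun _ : nat => 0 * 0)) by (rewrite Series_scal_l; ring).
  apply Series_le; [ | now apply (ex_series_hurwitz 0)].
  intros k. rewrite Rmult_0_l. split; [apply Rle_refl | ].
  apply Rlt_le, Rinv_0_lt_compat, pow_lt. pose proof (pos_INR k). lra.
Qed.

Lemma mean_value_pos (f df : R -> R) (a b : R) : 0 < a < b ->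
  (forall x, 0 < x -> is_derive f x (df x)) ->
  exists c, a <= c <= b /\ f b - f a = df c * (b - a).
Proof.
  intros Hab Hf.
  destruct (MVT_gen f a b df) as (c & Hc & E).
  - rewrite Rmin_left by lra. intros x Hx. apply Hf. lra.
  - rewrite Rmin_left by lra. intros x Hx. apply derivable_continuous_pt.
    exists (df x). apply is_derive_Reals, Hf. lra.
  - rewrite Rmin_left, Rmax_right in Hc by lra. now exists c.
Qed.

Lemma eq_of_is_derive_0 (f : R -> R) :
  (forall x, 0 < x -> is_derive f x 0) ->
  forall x, 0 < x -> f x = f 1.
Proof.
  intros Hf x Hx. destruct (Rtotal_order x 1) as [H | [-> | H]]; [ | reflexivity | ].
  - destruct (mean_value_pos f (fun _ => 0) x 1 ltac:(lra) Hf) as (c & _ & E). lra.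
  - destruct (mean_value_pos f (fun _ => 0) 1 x ltac:(lra) Hf) as (c & _ & E). lra.
Qed.

(** An antiderivative of the digamma series, corrected by a linear term, satisfies [log_increments];
    so it differs from [ln Gamma] by a constant. *)
Lemma ln_Gamma_derive : exists psi : R -> R,
  (forall x, 0 < x -> is_derive (fun y => ln (Gamma y)) x (psi x)) /\
  (forall x, 0 < x -> is_derive psi x (hurwitz 2 x)) /\
  (forall x, 0 < x -> psi x <= ln x <= psi (x + 1)).
Proof.
  set (H0 := fun x => RInt digamma_series 1 x).
  assert (Hcont : forall x, 0 < x -> continuous digamma_series x).
  { intros x Hx. apply (ex_derive_continuous (V := R_NormedModule)).
    exists (hurwitz 2 x). now apply is_derive_digamma_series. }
  assert (HdH0 : forall x, 0 < x -> is_derive H0 x (digamma_series x)).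
  { intros x Hx. apply (is_derive_RInt (V := R_NormedModule) digamma_series H0 1).
    - apply (filter_imp (F := locally x) (fun y => 0 < y)); [ | now apply locally_pos].
      intros y Hy. apply (RInt_correct (V := R_CompleteNormedModule)).
      apply (ex_RInt_continuous (V := R_CompleteNormedModule)). intros z Hz.
      apply Hcont. apply Rlt_le_trans with (2 := proj1 Hz). apply Rmin_pos; lra.
    - now apply Hcont. }
  (* The defect of [H0] in the functional equation is constant, because its derivative is 0 by
     [digamma_series_succ]. Subtracting [K * x] removes it. *)
  set (K := H0 (1 + 1) - H0 1 - ln 1).
  assert (HK : forall x, 0 < x -> H0 (x + 1) - H0 x - ln x = K).
  { apply (eq_of_is_derive_0 (fun x => H0 (x + 1) - H0 x - ln x)). intros x Hx.
    assert (Hs : is_derive (fun y => H0 (y + 1)) x (digamma_series (x + 1))).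
    { evar_last.
      - apply (is_derive_comp H0 (fun y => y + 1)); [apply HdH0; lra | ].
        auto_derive; [exact I | reflexivity].
      - unfold scal; simpl; unfold mult; simpl. ring. }
    evar_last.
    - apply (is_derive_minus (V := R_NormedModule));
        [apply (is_derive_minus (V := R_NormedModule)); [exact Hs | now apply HdH0] | ].
      apply is_derive_Reals, derivable_pt_lim_ln, Hx.
    - unfold minus, plus, opp; simpl. rewrite digamma_series_succ by exact Hx. ring. }
  set (psi := fun x => digamma_series x - K).
  set (H := fun x => H0 x - K * x).
  assert (HdH : forall x, 0 < x -> is_derive H x (psi x)).
  { intros x Hx. apply (is_derive_minus (V := R_NormedModule)); [now apply HdH0 | ].
    auto_derive; [exact I | ring]. }
  assert (Hdpsi : forall x, 0 < x -> is_derive psi x (hurwitz 2 x)).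
  { intros x Hx. evar_last.
    - apply (is_derive_minus (V := R_NormedModule));
        [now apply is_derive_digamma_series | apply (is_derive_const (V := R_NormedModule))].
    - unfold minus, plus, opp, zero; simpl. ring. }
  assert (Hmono : forall x y, 0 < x <= y -> psi x <= psi y).
  { intros x y [Hx [Hxy | ->]]; [ | apply Rle_refl].
    destruct (mean_value_pos psi (hurwitz 2) x y ltac:(lra) Hdpsi) as (c & Hc & E).
    pose proof (hurwitz_2_pos c ltac:(lra)). nra. }
  assert (Hsucc : forall x, 0 < x -> H (x + 1) = H x + ln x).
  { intros x Hx. unfold H. specialize (HK x Hx). lra. }
  (* The increment [H (x + 1) - H x = ln x] is a value of the increasing [psi] on [[x, x + 1]]. *)
  assert (Hbounds : forall x, 0 < x -> psi x <= ln x <= psi (x + 1)).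
  { intros x Hx.
    destruct (mean_value_pos H psi x (x + 1) ltac:(lra) HdH) as (c & Hc & E).
    rewrite Hsucc in E by exact Hx.
    pose proof (Hmono x c ltac:(lra)). pose proof (Hmono c (x + 1) ltac:(lra)). lra. }
  assert (Hincr : log_increments H).
  { split; [exact Hsucc | ]. intros y s Hy Hs.
    destruct (Rle_lt_or_eq_dec 0 s (proj1 Hs)) as [Hs0 | <-].
    - destruct (mean_value_pos H psi y (y + s) ltac:(lra) HdH) as (c & Hc & E).
      replace (y + s - y) with s in E by ring. rewrite E.
      pose proof (Hmono y c ltac:(lra)). pose proof (Hmono c (y + 1) ltac:(lra)).
      pose proof (proj1 (Hbounds (y + 1) ltac:(lra))).
      pose proof (proj2 (Hbounds (y - 1) ltac:(lra))) as Hlow.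
      replace (y - 1 + 1) with y in Hlow by ring. split; nra.
    - rewrite Rplus_0_r. lra. }
  exists psi. split; [ | now split]. intros x Hx.
  apply (is_derive_ext_loc (fun y => H y + (ln (Gamma 1) - H 1))).
  - apply (filter_imp (F := locally x) (fun y => 0 < y)); [ | now apply locally_pos].
    intros y Hy.
    pose proof (log_increments_unique _ _ ln_Gamma_log_increments Hincr y 1 Hy Rlt_0_1).
    simpl in *. lra.
  - evar_last.
    + apply (is_derive_plus (V := R_NormedModule));
        [now apply HdH | apply (is_derive_const (V := R_NormedModule))].
    + unfold plus, zero; simpl. ring.
Qed.

(** * Derivatives of [ln f] *)

(** Peeling off the innermost derivative as a function on the positive half-line makes closure under
    products and [exp] a plain induction. *)
Fixpoint derivable_upto (n : nat) (f : R -> R) : Prop :=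
  match n with
  | O => True
  | S n => exists g, (forall x, 0 < x -> is_derive f x (g x)) /\ derivable_upto n g
  end.

Lemma derivable_upto_pred (n : nat) (f : R -> R) :
  derivable_upto (S n) f -> derivable_upto n f.
Proof.
  revert f. induction n as [ | n IH]; intros f; [now intros | ].
  intros (g & Hg & H). exists g. split; [exact Hg | now apply IH].
Qed.

Lemma derivable_upto_plus (n : nat) (f g : R -> R) :
  derivable_upto n f -> derivable_upto n g -> derivable_upto n (fun x => f x + g x).
Proof.
  revert f g. induction n as [ | n IH]; intros f g; [now intros | ].
  intros (f' & Hf & Hf') (g' & Hg & Hg').
  exists (fun x => f' x + g' x). split; [ | now apply IH].
  intros x Hx. apply (is_derive_plus (V := R_NormedModule)); auto.
Qed.

Lemma derivable_upto_mult (n : nat) (f g : R -> R) :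
  derivable_upto n f -> derivable_upto n g -> derivable_upto n (fun x => f x * g x).
Proof.
  revert f g. induction n as [ | n IH]; intros f g; [now intros | ].
  intros Hf Hg.
  pose proof (derivable_upto_pred _ _ Hf). pose proof (derivable_upto_pred _ _ Hg).
  destruct Hf as (f' & Hf & Hf'), Hg as (g' & Hg & Hg').
  exists (fun x => f' x * g x + f x * g' x).
  split; [ | apply derivable_upto_plus; apply IH; assumption].
  intros x Hx. apply (is_derive_mult f g); auto. intros; apply Rmult_comm.
Qed.

Lemma derivable_upto_exp (n : nat) (f : R -> R) :
  derivable_upto n f -> derivable_upto n (fun x => exp (f x)).
Proof.
  revert f. induction n as [ | n IH]; intros f; [now intros | ].
  intros Hf. pose proof (IH _ (derivable_upto_pred _ _ Hf)) as He.
  destruct Hf as (g & Hg & Hg').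
  exists (fun x => g x * exp (f x)). split; [ | now apply derivable_upto_mult].
  intros x Hx. apply (is_derive_comp exp f); [apply is_derive_exp | now apply Hg].
Qed.

Lemma ex_derive_n_ext_pos (f g : R -> R) (n : nat) (x : R) :
  (forall y, 0 < y -> f y = g y) -> 0 < x -> ex_derive_n f n x -> ex_derive_n g n x.
Proof.
  intros E Hx. apply ex_derive_n_ext_loc.
  apply (filter_imp (F := locally x) (fun y => 0 < y)); [exact E | now apply locally_pos].
Qed.

Lemma derivable_upto_ex_derive_n (n : nat) (f : R -> R) (x : R) :
  derivable_upto n f -> 0 < x -> ex_derive_n f n x.
Proof.
  revert f x. induction n as [ | n IH]; intros f x H Hx; [exact I | ].
  destruct H as (g & Hg & H). destruct n as [ | n].
  - exists (g x). now apply Hg.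
  - apply (ex_derive_ext_loc (Derive_n g n)); [ | exact (IH g x H Hx)].
    apply (filter_imp (F := locally x) (fun y => 0 < y)); [ | now apply locally_pos].
    (* [Derive_n] adds derivatives on the outside, whereas [g] is the innermost one; [Derive_n_comp]
       exchanges the two orders. *)
    intros y Hy. replace (S n) with (n + 1)%nat by lia. rewrite <- Derive_n_comp.
    apply Derive_n_ext_loc.
    apply (filter_imp (F := locally y) (fun y => 0 < y)); [ | now apply locally_pos].
    intros z Hz. symmetry. now apply is_derive_unique, Hg.
Qed.

Lemma derivative_chain_Derive_n (d : nat -> R -> R) (f : R -> R) (n : nat) (x : R) :
  (forall k x, 0 < x -> is_derive (d k) x (d (S k) x)) ->
  (forall x, 0 < x -> f x = d O x) ->
  0 < x -> Derive_n f n x = d n x.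
Proof.
  intros Hd Hf. revert x. induction n as [ | n IH]; intros x Hx; [now apply Hf | ].
  simpl. rewrite <- (is_derive_unique _ _ _ (Hd n x Hx)). apply Derive_ext_loc.
  apply (filter_imp (F := locally x) (fun y => 0 < y)); [exact IH | now apply locally_pos].
Qed.

Lemma derivative_chain_derivable_upto (d : nat -> R -> R) (k n : nat) :
  (forall k x, 0 < x -> is_derive (d k) x (d (S k) x)) ->
  derivable_upto n (d k).
Proof.
  intros Hd. revert k. induction n as [ | n IH]; intros k; [exact I | ].
  exists (d (S k)). split; [apply Hd | apply IH].
Qed.

Definition ln_f_neg1 (alpha beta x : R) : R :=
  - (x + ln (Gamma (x + beta)) - (x + beta - alpha) * ln x).

Lemma f_neg1_exp (alpha beta x : R) : 0 <= beta -> 0 < x ->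
  f_neg1 alpha beta x = exp (ln_f_neg1 alpha beta x).
Proof.
  intros Hb Hx. unfold f_neg1, ln_f_neg1, Rpower.
  assert (HG : 0 < Gamma (x + beta)) by (apply Gamma_pos; lra).
  rewrite exp_Ropp. unfold Rminus at 2. rewrite exp_plus, exp_plus, exp_ln, exp_Ropp by exact HG.
  reflexivity.
Qed.

(** At order [m + 2] the factor [(-1) ^ m] is the required sign, so complete monotonicity amounts to
    a nonnegative bracket. *)
Definition ln_f_neg1_derivatives (psi : R -> R) (alpha beta : R) (n : nat) (x : R) : R :=
  match n with
  | O => ln_f_neg1 alpha beta x
  | 1%nat => ln x - psi (x + beta) + (beta - alpha) / x
  | S (S m) => (-1) ^ m *
      (INR (fact m) * / x ^ (m + 1) +
       INR (fact (m + 1)) * ((alpha - beta) * / x ^ (m + 2) - hurwitz (m + 2) (x + beta)))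
  end.

Lemma is_derive_shift (f : R -> R) (b x l : R) :
  is_derive f (x + b) l -> is_derive (fun y => f (y + b)) x l.
Proof.
  intros H. evar_last.
  - apply (is_derive_comp f (fun y => y + b)); [exact H | ].
    auto_derive; [exact I | reflexivity].
  - unfold scal; simpl; unfold mult; simpl. ring.
Qed.

Lemma is_derive_pow_inv (m : nat) (x : R) : 0 < x ->
  is_derive (fun y => / y ^ m) x (- INR m * / x ^ (m + 1)).
Proof.
  intros Hx. rewrite <- (Rplus_0_r x) at 2.
  apply (is_derive_ext (fun y => / (y + 0) ^ m)); [intros t; now rewrite Rplus_0_r | ].
  apply is_derive_inv_pow. lra.
Qed.

Lemma INR_fact_add_1 (m : nat) : INR (fact (m + 1)) = INR (m + 1) * INR (fact m).
Proof. rewrite <- mult_INR, Nat.add_1_r. reflexivity. Qed.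

Lemma is_derive_ln_f_neg1 (psi : R -> R) (alpha beta : R) (n : nat) (x : R) :
  (forall x, 0 < x -> is_derive (fun y => ln (Gamma y)) x (psi x)) ->
  (forall x, 0 < x -> is_derive psi x (hurwitz 2 x)) ->
  0 <= beta -> 0 < x ->
  is_derive (ln_f_neg1_derivatives psi alpha beta n) x
    (ln_f_neg1_derivatives psi alpha beta (S n) x).
Proof.
  intros HG Hpsi Hb Hx. destruct n as [ | [ | m]]; simpl ln_f_neg1_derivatives.
  - pose proof (is_derive_shift _ beta x _ (HG (x + beta) ltac:(lra))) as Hs.
    evar_last.
    + apply (is_derive_opp (V := R_NormedModule)).
      apply (is_derive_minus (V := R_NormedModule)).
      * apply (is_derive_plus (V := R_NormedModule));
          [apply (is_derive_id x) | exact Hs].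
      * assert (Hl : is_derive (fun y => (y + beta - alpha) * ln y) x
          (ln x + (x + beta - alpha) / x)) by (auto_derive; [lra | field; lra]).
        exact Hl.
    + unfold opp, minus, plus, opp, one; simpl. field. lra.
  - pose proof (is_derive_shift _ beta x _ (Hpsi (x + beta) ltac:(lra))) as Hs.
    evar_last.
    + apply (is_derive_plus (V := R_NormedModule)).
      * apply (is_derive_minus (V := R_NormedModule));
          [apply is_derive_Reals, derivable_pt_lim_ln, Hx | exact Hs].
      * assert (Hl : is_derive (fun y => (beta - alpha) / y) x
          (- (beta - alpha) / x ^ 2)) by (auto_derive; [lra | field; lra]).
        exact Hl.
    + unfold opp, minus, plus, opp; simpl. field. lra.
  - pose proof (is_derive_shift _ beta x _ (is_derive_hurwitz m (x + beta) ltac:(lra))) as Hs.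
    evar_last.
    + apply is_derive_scal. apply (is_derive_plus (V := R_NormedModule)).
      * apply is_derive_scal, is_derive_pow_inv, Hx.
      * apply is_derive_scal. apply (is_derive_minus (V := R_NormedModule)); [ | exact Hs].
        apply is_derive_scal, is_derive_pow_inv, Hx.
    + unfold minus, plus, opp; simpl.
      change (fact m + m * fact m)%nat with (fact (S m)).
      change (fact (m + 1) + (m + 1) * fact (m + 1))%nat with (fact (S (m + 1))).
      change (x * x ^ (m + 1)) with (x ^ S (m + 1)).
      change (x * x ^ (m + 2)) with (x ^ S (m + 2)).
      replace (S m) with (m + 1)%nat by lia.
      replace (S (m + 1)) with (m + 2)%nat by lia.
      replace (S (m + 2)) with (m + 3)%nat by lia.
      replace (m + 2 + 1)%nat with (m + 3)%nat by lia.
      replace (m + 2)%nat with (m + 1 + 1)%nat by lia.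
      rewrite !INR_fact_add_1. ring.
Qed.

(** * Signs of the derivatives of [ln f] and the equivalence *)

(* [psi (x + beta) - ln x] decreases, because its derivative is
   [hurwitz 2 (x + beta) - 1 / x], and it is at least [ln ((x + beta - 1) / x)],
   which tends to 0. *)
Lemma ln_le_psi (psi : R -> R) (beta x : R) :
  (forall x, 0 < x -> is_derive psi x (hurwitz 2 x)) ->
  (forall x, 0 < x -> ln x <= psi (x + 1)) ->
  1 / 2 <= beta -> 0 < x -> ln x <= psi (x + beta).
Proof.
  intros Hpsi Hlow Hb Hx.
  set (q := fun y => psi (y + beta) - ln y).
  assert (Hq : forall y, 0 < y -> is_derive q y (hurwitz 2 (y + beta) - / y)).
  { intros y Hy. apply (is_derive_minus (V := R_NormedModule)).
    - apply is_derive_shift, Hpsi. lra.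
    - apply is_derive_Reals, derivable_pt_lim_ln, Hy. }
  assert (Hfar : forall y, 1 + x < y -> - / (2 * y - 1) <= q x).
  { intros y Hy.
    destruct (mean_value_pos q _ x y ltac:(lra) Hq) as (c & Hc & E).
    pose proof (hurwitz_le 0 c beta ltac:(lra) Hb) as H. simpl in H.
    rewrite Rmult_1_r, Rmult_1_l in H.
    assert (q y <= q x) by nra.
    pose proof (Hlow (y + beta - 1) ltac:(lra)) as H1.
    replace (y + beta - 1 + 1) with (y + beta) in H1 by ring.
    assert (ln (y - 1 / 2) <= ln (y + beta - 1)) by (apply ln_le; lra).
    pose proof (ln_sub_le (y - 1 / 2) y ltac:(lra) ltac:(lra)) as H3.
    replace ((y - (y - 1 / 2)) / (y - 1 / 2)) with (/ (2 * y - 1)) in H3 by (field; lra).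
    unfold q in *. lra. }
  destruct (Rle_dec 0 (q x)) as [H | H]; [unfold q in H; lra | exfalso].
  (* Chosen so that [2 * y - 1 > / - q x], hence [- / (2 * y - 1) > q x], against [Hfar]. *)
  set (y := 1 + x + / - q x).
  assert (Hinv : 0 < / - q x) by (apply Rinv_0_lt_compat; lra).
  specialize (Hfar y ltac:(unfold y; lra)).
  assert (/ (2 * y - 1) < / / - q x).
  { apply Rinv_lt_contravar; [ | unfold y; lra].
    apply Rmult_lt_0_compat; [exact Hinv | unfold y; lra]. }
  rewrite Rinv_inv in *. lra.
Qed.

Lemma ln_f_neg1_derivatives_sign (psi : R -> R) (alpha beta : R) (n : nat) (x : R) :
  (forall x, 0 < x -> ln x <= psi (x + beta)) ->
  1 / 2 <= beta -> beta <= alpha -> (1 <= n)%nat -> 0 < x ->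
  0 <= (-1) ^ n * ln_f_neg1_derivatives psi alpha beta n x.
Proof.
  intros Hpsi Hb Hab Hn Hx. destruct n as [ | [ | m]]; [lia | | ];
    simpl ln_f_neg1_derivatives.
  - specialize (Hpsi x Hx).
    assert (0 <= (alpha - beta) / x) by (apply Rdiv_le_0_compat; lra).
    replace ((beta - alpha) / x) with (- ((alpha - beta) / x)) by (field; lra).
    simpl. lra.
  - replace (S (S m)) with (m + 2)%nat by lia. rewrite pow_add.
    set (A := _ + _). replace ((-1) ^ m * (-1) ^ 2 * ((-1) ^ m * A)) with A.
    2:{ replace ((-1) ^ m * (-1) ^ 2 * ((-1) ^ m * A)) with ((-1) ^ m * (-1) ^ m * A) by ring.
        rewrite <- Rpow_mult_distr. replace (-1 * -1) with 1 by ring. rewrite pow1. ring. }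
    unfold A.
    rewrite INR_fact_add_1. pose proof (hurwitz_le m x beta Hx Hb) as H.
    pose proof (INR_fact_lt_0 m). pose proof (pos_INR (m + 1)).
    assert (0 < / x ^ (m + 2)) by (apply Rinv_0_lt_compat, pow_lt, Hx).
    apply (Rmult_le_compat_l (INR (fact m))) in H; [ | lra].
    assert (0 <= INR (m + 1) * INR (fact m) * ((alpha - beta) * / x ^ (m + 2))).
    { repeat apply Rmult_le_pos; lra. }
    lra.
Qed.

(** An explicit majorant that vanishes as [x] tends to 0. With [s] and [t] the square roots of [x]
    and [x + b], the left side is [2 * s * s * (ln t - ln s) <= 2 * s * (t - s)]. *)
Lemma mul_ln_one_plus_le (x b : R) : 0 < x -> 0 < b ->
  x * (ln (x + b) - ln x) <= 2 * sqrt (x * (x + b)).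
Proof.
  intros Hx Hb. set (s := sqrt x). set (t := sqrt (x + b)).
  assert (Hs : 0 < s) by (apply sqrt_lt_R0; lra).
  assert (Ht : 0 < t) by (apply sqrt_lt_R0; lra).
  rewrite sqrt_mult by lra. fold s t.
  assert (Es : x = s * s) by (unfold s; now rewrite sqrt_sqrt by lra).
  assert (Et : x + b = t * t) by (unfold t; now rewrite sqrt_sqrt by lra).
  rewrite Et. clearbody s t. rewrite Es. rewrite !ln_mult by assumption.
  pose proof (ln_sub_le s t Hs Ht) as H.
  assert (s * (ln t - ln s) <= t - s).
  { apply (Rmult_le_compat_l s) in H; [ | lra].
    replace (s * ((t - s) / s)) with (t - s) in H by (field; lra). exact H. }
  nra.
Qed.

Theorem theorem2 :
  forall alpha beta : R, 1 / 2 <= beta ->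
    (log_completely_monotonic (f_neg1 alpha beta) (Finite 0) p_infty
     <-> alpha >= beta).
Proof.
  intros alpha beta Hb.
  destruct ln_Gamma_derive as (psi & HG & Hpsi & Hbounds).
  set (d := ln_f_neg1_derivatives psi alpha beta).
  assert (Hd : forall k x, 0 < x -> is_derive (d k) x (d (S k) x)).
  { intros k x Hx. apply is_derive_ln_f_neg1; [exact HG | exact Hpsi | lra | exact Hx]. }
  assert (Hexp : forall x, 0 < x -> f_neg1 alpha beta x = exp (d O x)).
  { intros x Hx. apply f_neg1_exp; lra. }
  assert (HD : forall n x, 0 < x ->
    Derive_n (fun y => ln (f_neg1 alpha beta y)) n x = d n x).
  { intros n x. apply derivative_chain_Derive_n; [exact Hd | ].
    intros y Hy. now rewrite Hexp, ln_exp. }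
  split.
  - intros (_ & _ & H). apply Rnot_lt_ge. intros Hab. set (e := beta - alpha).
    (* The sign at order 1 gives [e / x <= psi (x + beta) - ln x <= ln (x + beta) - ln x]. *)
    assert (Hneg : forall x, 0 < x -> e <= 2 * sqrt (x * (x + beta))).
    { intros x Hx. apply Rle_trans with (2 := mul_ln_one_plus_le x beta Hx ltac:(lra)).
      specialize (H 1%nat x (le_n _) Hx I). rewrite HD in H by exact Hx. simpl in H.
      pose proof (proj1 (Hbounds (x + beta) ltac:(lra))) as Hup.
      assert (H1 : e / x <= ln (x + beta) - ln x) by (unfold e; lra).
      apply Rle_div_l in H1; lra. }
    (* For this [x], [4 * x * (x + beta) <= 4 * x * (1 + beta) <= e * e / 2], which contradicts the
       square of [Hneg]. *)
    set (x := Rmin 1 (e * e / (8 * (1 + beta)))).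
    assert (He : 0 < e) by (unfold e; lra).
    assert (Hx : 0 < x).
    { apply Rmin_pos; [lra | apply Rdiv_lt_0_compat; nra]. }
    assert (Hx1 : x <= 1) by apply Rmin_l.
    assert (Hx2 : x <= e * e / (8 * (1 + beta))) by apply Rmin_r.
    apply Rle_div_r in Hx2; [ | lra].
    specialize (Hneg x Hx).
    assert (Hsq : sqrt (x * (x + beta)) * sqrt (x * (x + beta)) = x * (x + beta))
      by (apply sqrt_sqrt; nra).
    pose proof (sqrt_pos (x * (x + beta))). nra.
  - intros Hab. split; [ | split].
    + intros x Hx _. rewrite Hexp by exact Hx. apply exp_pos.
    + intros n x Hx _.
      (* Derivability is required of [f] itself, while the explicit chain is that of [ln f]; the
         exponential carries it over. *)
      apply (ex_derive_n_ext_pos (fun y => exp (d O y)));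
        [intros; symmetry; now apply Hexp | exact Hx | ].
      apply derivable_upto_ex_derive_n; [ | exact Hx].
      apply derivable_upto_exp. now apply derivative_chain_derivable_upto.
    + intros n x Hn Hx _. rewrite HD by exact Hx.
      apply ln_f_neg1_derivatives_sign; try assumption; [ | lra].
      intros y Hy. apply ln_le_psi; try assumption.
      intros z Hz. now apply Hbounds.
Qed.
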